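(* Let $\alpha\in[0,1)$ be a rational with continued fraction expansion $[0,a_1,\dots,a_r,1]$ and convergent denominators $q_0,\dots,q_{r+1}$. The map $$\Psi_\alpha : E_\alpha\to\{0,1,\dots,q_{r+1}-1\},\qquad d\mapsto\sum_{j=1}^r d_jq_{j-1}$$ is an order isomorphism between $(E_\alpha,\leqslant_R)$ and $(\{0,\dots,q_{r+1}-1\},\leqslant)$.
   Context: Every rational $\alpha\in(0,1)$ has a unique continued fraction expansion ending in $1$: $\alpha=[0,a_1,\dots,a_r,1]$ with $r\geqslant1$ and positive integers $a_1,\dots,a_r$, where $[x]=x$ and $[x,x_1,\dots,x_n]=x+1/[x_1,\dots,x_n]$. Put $a_0=0$, $a_{r+1}=1$, $p_{-1}=1,\ q_{-1}=0,\ p_0=0,\ q_0=1$, and $p_n=a_np_{n-1}+p_{n-2}$, $q_n=a_nq_{n-1}+q_{n-2}$ for $1\leqslant n\leqslant r+1$; thus $\alpha=p_{r+1}/q_{r+1}$ in lowest terms. $E_\alpha$ is the set of $\alpha$-admissible sequences: sequences $d=(d_1,\dots,d_r)$ of nonnegative integers such that for all $j\in\{1,\dots,r\}$: $0\leqslant d_j\leqslant a_j$, and if $d_j=0$ then either $d_i=0$ for all $i\geqslant j$, or $j\geqslant2$ and $d_{j-1}=a_{j-1}$ (so the zero sequence is the only element with $d_1=0$). Reversed lexicographic order: $d\leqslant_R d'$ iff $d=d'$ or there is $j\in\{1,\dots,r\}$ with $d_j<d'_j$ and $d_i=d'_i$ for all $i>j$. *)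

(* Defs.v *)
From HB Require Import structures.
From mathcomp Require Import all_boot all_order all_algebra.
From mathcomp Require Import mathcomp_extra boolp classical_sets functions.

Set Implicit Arguments.
Unset Strict Implicit.
Unset Printing Implicit Defensive.

Local Open Scope classical_set_scope.
Local Open Scope nat_scope.

(* A finite sequence (x_1, ..., x_r) is indexed from 1, with x_0 = 0; out of
   range entries are 0. *)
Definition entry (x : seq nat) (j : nat) : nat := nth 0 (0 :: x) j.

(* [x] = x and [x, x_1, ..., x_n] = x + 1 / [x_1, ..., x_n] *)
Fixpoint cfrac (x : rat) (s : seq rat) : rat :=
  if s is y :: s' then (x + 1 / cfrac y s')%R else x.

Definition cf_expansion (r : nat) (a : r.-tuple nat) (alpha : rat) : Prop :=
  [/\ 1 <= r,
      forall j, 1 <= j <= r -> 0 < entry a j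
    & alpha = cfrac 0%R [seq n%:R%R | n <- rcons a 1]].

(* q_0 = 1 and q_n = a_n q_(n-1) + q_(n-2), where q_(-1) = 0; appending 1 to
   a sets a_(r+1) = 1, so that the values are meaningful for n <= r+1. *)
Fixpoint cf_denom (a : seq nat) (n : nat) : nat :=
  if n is n'.+1 then
    entry (rcons a 1) n * cf_denom a n' + (if n' is m.+1 then cf_denom a m else 0)
  else 1.

Definition admissible (r : nat) (a : r.-tuple nat) : set (r.-tuple nat) :=
  [set d | forall j, 1 <= j <= r ->
     entry d j <= entry a j /\
     (entry d j = 0 ->
        (forall i, j <= i <= r -> entry d i = 0) \/
        (2 <= j /\ entry d j.-1 = entry a j.-1))].

Definition revlex_le (r : nat) (d d' : r.-tuple nat) : Prop :=
  d = d' \/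
  exists j, [/\ 1 <= j <= r, entry d j < entry d' j
              & forall i, j < i <= r -> entry d i = entry d' i].

Definition Psi (r : nat) (a d : r.-tuple nat) : nat :=
  \sum_(1 <= j < r.+1) entry d j * cf_denom a j.-1.

Definition order_isomorphism (S T : Type) (A : set S) (leA : S -> S -> Prop)
    (B : set T) (leB : T -> T -> Prop) (f : S -> T) : Prop :=
  set_bij A B f /\
  (forall x y, A x -> A y -> (leA x y <-> leB (f x) (f y))).

(* Main.v *)
Require Import Defs.
From HB Require Import structures.
From mathcomp Require Import all_boot all_order all_algebra.
From mathcomp Require Import mathcomp_extra boolp classical_sets functions.
From mathcomp Require Import zify.

(** Why the theorem holds.  Write S_k for the partial sum of [d_j q_(j-1)] over
    [1 <= j <= k], with [q_(-1) = 0].  A nonzero admissible sequence consists of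
    an initial stretch in which every zero digit is preceded by a maximal one,
    followed by zeros only.  Along the stretch the partial sums are confined to
    a band: [q_(k-1) <= S_k < q_k + q_(k-1)] ([prev_denom_le_partial_sum],
    [partial_sum_lt]).

    The band at [k - 1] has width exactly [q_(k-1)], the weight of [d_k].  Hence
    raising [d_k] by one outweighs any admissible change of the lower digits, so
    that [Psi] is strictly increasing for the reversed lexicographic order
    ([revlex_lt_partial_sum]); that order being total ([last_difference]),
    [Psi] is injective and reflects the order as well.

    For the same reason Euclidean division of [N - q_(k-1)] by [q_k] extracts
    the digit [d_(k+1)] of any [N] in the band at [k + 1], leaving a remainder
    in the band at [k] ([band_representation]).  The bands cover
    [{0, ..., q_r + q_(r-1) - 1}] ([bands_cover]) and
    [q_r + q_(r-1) = q_(r+1)] because [a_(r+1) = 1], whence surjectivity. *)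

Set Implicit Arguments.
Unset Strict Implicit.
Unset Printing Implicit Defensive.

Local Open Scope classical_set_scope.
Local Open Scope nat_scope.

(** * Convergent denominators *)

Definition quotient (a : seq nat) : nat -> nat := entry (rcons a 1).

(** The denominator [q_(k-1)], with the convention [q_(-1) = 0] that makes the
    recurrence [cf_denomS] hold from the start. *)
Definition prev_denom (a : seq nat) (k : nat) : nat :=
  if k is m.+1 then cf_denom a m else 0.

Lemma cf_denomS (a : seq nat) (k : nat) :
  cf_denom a k.+1 = quotient a k.+1 * cf_denom a k + prev_denom a k.
Proof. by []. Qed.

Lemma quotient_entry (a : seq nat) (j : nat) :
  j <= size a -> quotient a j = entry a j.
Proof.
case: j => [//|j] hj; rewrite /quotient /entry /=.
by rewrite nth_rcons hj.
Qed.

Lemma quotient_last (a : seq nat) : quotient a (size a).+1 = 1.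
Proof. by rewrite /quotient /entry /= nth_rcons ltnn eqxx. Qed.

Definition positive_quotients (a : seq nat) (k : nat) : Prop :=
  forall j, 1 <= j <= k -> 0 < quotient a j.

Lemma prev_denom_le (a : seq nat) (k : nat) :
  positive_quotients a k -> prev_denom a k <= cf_denom a k.
Proof.
case: k => [//|k] apos; rewrite cf_denomS /=.
have := apos k.+1; rewrite leqnn => /(_ isT); nia.
Qed.

Lemma cf_denom_gt0 (a : seq nat) (k : nat) :
  positive_quotients a k -> 0 < cf_denom a k.
Proof.
elim: k => [//|k IHk] apos; apply: leq_trans (prev_denom_le apos).
by apply: IHk => j hj; apply: apos; lia.
Qed.

(** * Bounds on partial sums *)

(** Digit strings are functions here, read from index 1 on, so that they can be
    truncated and extended freely. *)
Definition partial_sum (a : seq nat) (d : nat -> nat) (k : nat) : nat :=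
  \sum_(1 <= j < k.+1) d j * cf_denom a j.-1.

Lemma partial_sum0 (a : seq nat) (d : nat -> nat) : partial_sum a d 0 = 0.
Proof. by rewrite /partial_sum big_geq. Qed.

Lemma partial_sumS (a : seq nat) (d : nat -> nat) (k : nat) :
  partial_sum a d k.+1 = partial_sum a d k + d k.+1 * cf_denom a k.
Proof. by rewrite /partial_sum big_nat_recr. Qed.

Lemma eq_partial_sum (a : seq nat) (d d' : nat -> nat) (k : nat) :
  (forall j, 1 <= j <= k -> d j = d' j) ->
  partial_sum a d k = partial_sum a d' k.
Proof. by move=> dd'; apply: eq_big_nat => j hj; rewrite dd'. Qed.

Lemma partial_sum_pad (a : seq nat) (d : nat -> nat) (m k : nat) :
  m <= k -> (forall j, m < j <= k -> d j = 0) ->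
  partial_sum a d k = partial_sum a d m.
Proof.
elim: k => [|k IHk] hmk d0; first by congr partial_sum; lia.
have [->//|mk] := eqVneq m k.+1.
rewrite partial_sumS d0; last by lia.
by rewrite addn0 IHk // => [|j hj]; [lia | apply: d0; lia].
Qed.

Definition bounded (a : seq nat) (d : nat -> nat) (k : nat) : Prop :=
  forall j, 1 <= j <= k -> d j <= quotient a j.

(** Admissibility without the escape clause for trailing zeros: a zero digit
    must follow a maximal one; in particular [d 1] is nonzero. *)
Definition unbroken (a : seq nat) (d : nat -> nat) (k : nat) : Prop :=
  forall j, 1 <= j <= k -> d j = 0 -> 2 <= j /\ d j.-1 = quotient a j.-1.

(** Taking every digit maximal gives [q_k + q_(k-1) - 1]: the sum telescopes
    through [a_j q_(j-1) = q_j - q_(j-2)]. *)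
Lemma partial_sum_lt (a : seq nat) (d : nat -> nat) (k : nat) :
  bounded a d k -> partial_sum a d k < cf_denom a k + prev_denom a k.
Proof.
elim: k => [|k IHk] db; first by rewrite partial_sum0.
have {}IHk : partial_sum a d k < cf_denom a k + prev_denom a k.
  by apply: IHk => j hj; apply: db; lia.
have : d k.+1 <= quotient a k.+1 by apply: db; lia.
rewrite partial_sumS cf_denomS /=; nia.
Qed.

(** A last digit short of its maximum costs a weight [q_(k-1)], which lowers the
    strict upper bound of [partial_sum_lt] to [q_k]. *)
Lemma last_digit_maximal (a : seq nat) (d : nat -> nat) (k : nat) :
  0 < k -> bounded a d k -> cf_denom a k <= partial_sum a d k ->
  d k = quotient a k.
Proof.
case: k => [//|k] _ db; rewrite partial_sumS cf_denomS.
have : partial_sum a d k < cf_denom a k + prev_denom a k.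
  by apply: partial_sum_lt => j hj; apply: db; lia.
have : d k.+1 <= quotient a k.+1 by apply: db; lia.
nia.
Qed.

(** A nonzero last digit contributes [q_(k-1)] by itself.  A zero one follows a
    maximal digit, and [a_(k-1) q_(k-2)] together with the bound [q_(k-3)] for
    the digits further below is again [q_(k-1)]; this is why the induction goes
    back two steps. *)
Lemma prev_denom_le_partial_sum (a : seq nat) (d : nat -> nat) (k : nat) :
  unbroken a d k -> prev_denom a k <= partial_sum a d k.
Proof.
have [n] := ubnP k; elim: n k => [//|n IHn] [|k] hk du //=.
rewrite partial_sumS; have [dk0|dkn0] := eqVneq (d k.+1) 0; last by nia.
have [|k2 dk] := du k.+1 _ dk0; first by lia.
case: k => [|k] in hk du dk dk0 k2 *; first by lia.
rewrite partial_sumS cf_denomS dk /=.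
have : prev_denom a k <= partial_sum a d k; last by lia.
by apply: IHn => [|j hj]; [lia | apply: du; lia].
Qed.

(** * Monotonicity *)

(** At [j] the excess of [d'] is at least [q_(j-1)].  Below [j] the sum of [d']
    is at least the bottom of a band of width [q_(j-1)], and that of [d] is below
    its top. *)
Lemma revlex_lt_partial_sum (a : seq nat) (d d' : nat -> nat) (j k : nat) :
  1 <= j <= k -> bounded a d k -> unbroken a d' j -> d j < d' j ->
  (forall i, j < i <= k -> d i = d' i) ->
  partial_sum a d k < partial_sum a d' k.
Proof.
case: j => [//|j] /= hjk db du dlt.
elim: k hjk db => [//|k IHk] hjk db dd'; rewrite !partial_sumS.
have [[ejk]|njk] := eqVneq j.+1 k.+1; last first.
  have : partial_sum a d k < partial_sum a d' k.
    by apply: IHk => [|i hi|i hi]; [lia | apply: db; lia | apply: dd'; lia].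
  have -> : d k.+1 = d' k.+1 by apply: dd'; lia.
  by lia.
have ub : partial_sum a d k < cf_denom a k + prev_denom a k.
  by apply: partial_sum_lt => i hi; apply: db; lia.
have lb : prev_denom a k <= partial_sum a d' k.
  by apply: prev_denom_le_partial_sum => i hi; apply: du; lia.
rewrite ejk in dlt; nia.
Qed.

Lemma last_difference (d d' : nat -> nat) (k : nat) :
  (forall j, 1 <= j <= k -> d j = d' j) \/
  exists j, [/\ 1 <= j <= k, d j != d' j & forall i, j < i <= k -> d i = d' i].
Proof.
elim: k => [|k IHk]; first by left=> j; lia.
have [e|ne] := eqVneq (d k.+1) (d' k.+1); last first.
  by right; exists k.+1; split=> // [|i]; lia.
have ext i : (1 <= i <= k -> d i = d' i) -> 1 <= i <= k.+1 -> d i = d' i.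
  by move=> h hi; have [->//|] := eqVneq i k.+1; move=> ?; apply: h; lia.
case: IHk => [h|[j [hj dj h]]].
  by left=> i; apply: ext => hi; apply: h.
right; exists j; split=> // [|i hi]; first by lia.
by apply: ext => [?|]; [apply: h; lia | lia].
Qed.

(** * Surjectivity *)

(** The digit [c] at [k + 1] is the quotient of [N - q_(k-1)] by [q_k], so that
    [N - c q_k] lands in the band at [k]. *)
Lemma band_representation (a : seq nat) (k N : nat) :
  positive_quotients a k ->
  prev_denom a k <= N < cf_denom a k + prev_denom a k ->
  exists d : nat -> nat,
    [/\ bounded a d k, unbroken a d k & partial_sum a d k = N].
Proof.
elim: k N => [|k IHk] N apos.
  move=> /= N0; exists (fun=> 0); rewrite partial_sum0.
  by split=> [j|j|]; lia.
rewrite cf_denomS /= => hN.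
have apos' : positive_quotients a k by move=> j hj; apply: apos; lia.
have qle := prev_denom_le apos'; have q0 := cf_denom_gt0 apos'.
set p := prev_denom a k in hN qle *; set q := cf_denom a k in hN qle q0 *.
have hdiv := divn_eq (N - p) q; have hmod := ltn_pmod (N - p) q0.
set c := (N - p) %/ q in hdiv *; set m := (N - p) %% q in hdiv hmod.
have cle : c <= quotient a k.+1 by nia.
have [||d [db du dS]] := IHk (p + m) => //; first by rewrite -/p -/q; lia.
pose d' j := if j == k.+1 then c else d j.
have d'E j : j <= k -> d' j = d j.
  by rewrite /d' => hj; case: eqVneq => // ?; lia.
have d'c : d' k.+1 = c by rewrite /d' eqxx.
exists d'; split.
- move=> j hj; have [->|nj] := eqVneq j k.+1; first by rewrite d'c.
  by rewrite d'E; [apply: db; lia | lia].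
- move=> j hj; have [->|nj] := eqVneq j k.+1; last first.
    by rewrite !d'E; [apply: du; lia | lia | lia].
  rewrite d'c d'E // => c0.
  (* Then N itself is the sum up to k, and N >= q_k forces d k to be maximal. *)
  have Nm : N = p + m by nia.
  have k0 : 0 < k.
    case: (posnP k) => // k0; move: hN Nm hmod.
    by rewrite /p /q k0 /=; lia.
  split; first by lia.
  by apply: last_digit_maximal; rewrite // dS -/q; lia.
- rewrite partial_sumS d'c (@eq_partial_sum a d' d) => [|j hj].
    by rewrite dS -/q; lia.
  by apply: d'E; lia.
Qed.

Lemma bands_cover (a : seq nat) (k N : nat) :
  N < cf_denom a k + prev_denom a k ->
  exists2 m, m <= k & prev_denom a m <= N < cf_denom a m + prev_denom a m.
Proof.
elim: k => [|k IHk] hN; first by exists 0.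
have [qN|Nq] := leqP (cf_denom a k) N; first by exists k.+1; rewrite //= qN.
by have [|m mk hm] := IHk; [lia | exists m => //; lia].
Qed.

(** * Admissible tuples *)

Lemma admissible_bounded (r : nat) (a d : r.-tuple nat) :
  admissible a d -> bounded a (entry d) r.
Proof.
move=> hd j hj; rewrite quotient_entry ?size_tuple; last by lia.
by case: (hd j hj).
Qed.

Lemma admissible_unbroken (r : nat) (a d : r.-tuple nat) (j : nat) :
  admissible a d -> j <= r -> 0 < entry d j -> unbroken a (entry d) j.
Proof.
move=> hd jr dj i hi di0.
have [|_ /(_ di0) [z|[i2 e]]] := hd i; first by lia.
  by have := z j; lia.
by rewrite quotient_entry ?size_tuple //; lia.
Qed.

Lemma entry_mktuple (r : nat) (d : nat -> nat) (j : nat) :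
  1 <= j <= r -> entry [tuple d i.+1 | i < r] j = d j.
Proof.
case: j => [//|j] hj; rewrite /entry /=.
have jr : j < r by lia.
by rewrite (nth_map (Ordinal jr)) ?size_enum_ord // nth_enum_ord.
Qed.

Lemma eq_entry_tuple (r : nat) (d d' : r.-tuple nat) :
  (forall j, 1 <= j <= r -> entry d j = entry d' j) -> d = d'.
Proof.
move=> h; apply: val_inj; apply: (@eq_from_nth _ 0); rewrite ?size_tuple //.
by move=> i ir; apply: (h i.+1); lia.
Qed.

Definition revlex_lt (r : nat) (d d' : r.-tuple nat) : Prop :=
  exists j, [/\ 1 <= j <= r, entry d j < entry d' j
              & forall i, j < i <= r -> entry d i = entry d' i].

Lemma revlex_trichotomy (r : nat) (d d' : r.-tuple nat) :
  [\/ d = d', revlex_lt d d' | revlex_lt d' d].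
Proof.
have [h|[j [hj dj h]]] := last_difference (entry d) (entry d') r.
  by constructor 1; apply: eq_entry_tuple.
case: (ltngtP (entry d j) (entry d' j)) dj => // dj _.
  by constructor 2; exists j.
by constructor 3; exists j; split=> // i hi; rewrite h.
Qed.

Lemma Psi_lt (r : nat) (a d d' : r.-tuple nat) :
  admissible a d -> admissible a d' -> revlex_lt d d' -> Psi a d < Psi a d'.
Proof.
move=> hd hd' [j [hj dj h]].
apply: (@revlex_lt_partial_sum a (entry d) (entry d') j r) => //.
  exact: admissible_bounded.
by apply: admissible_unbroken => //; lia.
Qed.

Lemma Psi_surj (r : nat) (a : r.-tuple nat) (N : nat) :
  positive_quotients a r -> N < cf_denom a r + prev_denom a r ->
  exists2 d, admissible a d & Psi a d = N.
Proof.
move=> apos /bands_cover [m mr /band_representation].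
case=> [j hj|d [db du dS]]; first by apply: apos; lia.
pose d' j := if j <= m then d j else 0.
have d'E j : j <= m -> d' j = d j by rewrite /d' => ->.
have d'0 j : m < j -> d' j = 0 by rewrite /d' ltnNge => /negbTE ->.
exists [tuple d' i.+1 | i < r].
  move=> j hj; rewrite entry_mktuple // -quotient_entry ?size_tuple; last by lia.
  have [jm|mj] := leqP j m.
    rewrite d'E //; split=> [|dj0]; first by apply: db; lia.
    have [|j2 dj] := du j _ dj0; first by lia.
    right; split=> //; rewrite entry_mktuple; last by lia.
    rewrite d'E; last by lia.
    by rewrite dj quotient_entry ?size_tuple //; lia.
  rewrite d'0 //; split=> // _; left=> i hi.
  by rewrite entry_mktuple ?d'0 //; lia.
rewrite -dS; transitivity (partial_sum a d' r).
  by apply: eq_partial_sum => j hj; apply: entry_mktuple.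
rewrite (@partial_sum_pad a d' m r) // => [|j /andP[mj _]]; last exact: d'0.
by apply: eq_partial_sum => j hj; apply: d'E; lia.
Qed.

(** * The order isomorphism *)

Theorem proposition2 (alpha : rat) (r : nat) (a : r.-tuple nat)
    (halpha : (0 <= alpha < 1)%R) (ha : cf_expansion a alpha) :
  order_isomorphism (admissible a) (@revlex_le r)
    [set n : nat | n < cf_denom a r.+1] (fun m n : nat => m <= n)
    (Psi a).
Proof.
have [_ aentry _] := ha.
have apos : positive_quotients a r.
  move=> j hj; rewrite quotient_entry ?size_tuple; last by lia.
  exact: aentry.
have qE : cf_denom a r.+1 = cf_denom a r + prev_denom a r.
  have := quotient_last a; rewrite size_tuple cf_denomS => ->.
  by rewrite mul1n.
split; first split.
- move=> d hd; rewrite /mkset qE.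
  exact/(@partial_sum_lt a (entry d) r)/admissible_bounded.
- move=> d d' /set_mem hd /set_mem hd' e.
  case: (revlex_trichotomy d d') => // /Psi_lt => [/(_ a hd hd')|/(_ a hd' hd)];
    by rewrite e ltnn.
- move=> N; rewrite /mkset qE => /(Psi_surj apos) [d hd <-].
  by exists d.
move=> d d' hd hd'; split=> [[->//|/(Psi_lt hd hd')]|le]; first exact: ltnW.
case: (revlex_trichotomy d d') => [->|lt|/(Psi_lt hd' hd)]; [by left|by right|].
by rewrite ltnNge le.
Qed.
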